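(* Let $x>0$ be a positive rational number. Then \[ x=\frac{\#\mathcal{M}^\perp(x)}{\#\mathcal{M}^\parallel(x)} \] and the fraction on the right-hand side is reduced.
   Context: Let $[a_0;\dots,a_{2\ell-1}]$ be the even-length continued fraction expansion of $x$ ($\ell\ge1$, $a_0\ge0$, $a_i\ge1$ for $i\ge1$) and $W(x)=\mathtt{1}^{a_0}\mathtt{0}^{a_1}\cdots\mathtt{1}^{a_{2\ell-2}}\mathtt{0}^{a_{2\ell-1}-1}$. Define $\theta$ on words over $\{\mathtt0,\mathtt1\}$ by $\theta(\varepsilon)=\varepsilon$ and $\theta(\alpha w)=\overline{\alpha}\theta(w)$ if $|w|$ is even, $\alpha\theta(w)$ if $|w|$ is odd, where $\overline{\mathtt0}=\mathtt1,\overline{\mathtt1}=\mathtt0$. For a word $p$, $\vec p=(|p|_\mathtt0,|p|_\mathtt1)$; $S_g$ denotes the four edges of the unit square with lower-left corner $g\in\mathbb{Z}^2$. The snake graph $G(w)$ has vertex set $\{\vec p: p\text{ prefix of }w\}+\{(0,0),(1,0),(0,1),(1,1)\}$ and edge set $\bigcup_{p\text{ prefix of }w}S_{\vec p}$. $\mathcal{G}(x)=G(w)$ with $w=\theta(W(x))$. The first edge of a perfect matching is the edge containing $(0,0)$. A perfect matching is a $\perp$-matching if ($|w|$ even and its first edge is horizontal) or ($|w|$ odd and its first edge is vertical), and a $\parallel$-matching otherwise; $\mathcal{M}^\perp(x)$, $\mathcal{M}^\parallel(x)$ denote the sets of such perfect matchings of $\mathcal{G}(x)$. *)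

(* Defs.v *)
From HB Require Import structures.
From mathcomp Require Import all_boot all_order all_algebra.
From mathcomp Require Import finmap.
From mathcomp Require Import zify ring lra.

Set Implicit Arguments.
Unset Strict Implicit.
Unset Printing Implicit Defensive.

Import Order.TTheory GRing.Theory Num.Theory.
Local Open Scope fset_scope.
Local Open Scope ring_scope.

(* Value of [a_0; ...; a_(n-1)]. *)
Fixpoint cf_val (a : seq nat) : rat :=
  match a with
  | [::] => 0
  | [:: k] => k%:R
  | k :: s => k%:R + (cf_val s)^-1
  end.

Definition is_even_cf (x : rat) (a : seq nat) : bool :=
  [&& a != [::], ~~ odd (size a), all (leq 1) (behead a) & cf_val a == x].

Lemma cf_val_cons k s : cf_val (k :: s) = k%:R + (cf_val s)^-1.
Proof. by case: s => //=; rewrite invr0 addr0. Qed.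

Lemma cf_ex (p q : nat) (b : bool) : (0 < p)%N -> (0 < q)%N ->
  exists a, [&& a != [::], odd (size a) == b, all (leq 1) (behead a),
     (q < p)%N ==> (0 < head 0 a)%N & cf_val a == p%:R / q%:R].
Proof.
elim/ltn_ind: q p b => q IH p b p0 q0.
have qn0 : (q%:R : rat) != 0 by rewrite pnatr_eq0; lia.
have [r0|r0] := posnP (p %% q).
  have pE := divn_eq p q; rewrite r0 addn0 in pE.
  set k := (p %/ q)%N in pE.
  have k0 : (0 < k)%N by case: k pE => //; lia.
  case: b.
    exists [:: k]; rewrite /= k0 implybT /= pE natrM mulfK //.
  exists [:: k.-1; 1%N] => /=.
  rewrite invr1 pE natrM mulfK // -[X in _ + X]/(1%:R) -natrD addn1 prednK // eqxx andbT.
  by apply/implyP => lt; nia.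
have [s /and5P[s0 os als hs /eqP vs]] := IH _ (ltn_pmod p q0) q (~~ b) q0 r0.
exists ((p %/ q)%N :: s); rewrite cf_val_cons vs /=.
rewrite ltn_pmod // implyTb in hs.
case: s s0 os als hs {vs} => // h s _ os als hs.
rewrite [all _ _]/= hs als (eqP os) negbK eqxx /=.
apply/andP; split.
  by apply/implyP => lt; rewrite divn_gt0 // ltnW.
apply/eqP; rewrite invf_div [in RHS](divn_eq p q) natrD natrM mulrDl mulfK //.
Qed.

Lemma even_cf_exists (x : rat) : exists a, (0 < x) ==> is_even_cf x a.
Proof.
case: (boolP (0 < x)) => x0; last by exists [::].
have n0 : (0 < `|numq x|)%N by rewrite absz_gt0 numq_eq0 gt_eqF.
have d0 : (0 < `|denq x|)%N by rewrite absz_gt0 denq_eq0.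
have [a /and5P[a0 oa ala _ /eqP va]] := cf_ex false n0 d0.
exists a; rewrite /is_even_cf a0 -(eqbF_neg) oa ala va /=.
apply/eqP; rewrite -[RHS]divq_num_den !natr_absz.
by rewrite (ger0_norm (denq_ge0 x)) ger0_norm // numq_ge0 ltW.
Qed.

Lemma cf_val_ge1 s : s != [::] -> all (leq 1) s ->
  1 <= cf_val s ?= iff (s == [:: 1%N]).
Proof.
elim: s => // k s IH _ /andP[k0 als].
have [->|s0] := eqVneq s [::].
  split; rewrite /= ?ler1n // eq_sym pnatr_eq1 /eq_op /= andbT //.
have v1 := (IH s0 als).1.
have k1 : (1 : rat) <= k%:R by rewrite ler1n.
have i0 : 0 < (cf_val s)^-1 by rewrite invr_gt0; lra.
rewrite cf_val_cons; split; first by lra.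
have -> : (k :: s == [:: 1%N]) = false by case: s s0 {IH als v1 i0} => // *; rewrite /eq_op /= andbF.
by apply/negbTE; rewrite neq_lt; apply/orP; left; lra.
Qed.

Lemma cf_val_uniq a b : a != [::] -> b != [::] -> odd (size a) = odd (size b) ->
  all (leq 1) (behead a) -> all (leq 1) (behead b) -> cf_val a = cf_val b -> a = b.
Proof.
have inv_lt1 (v : rat) : 1 < v -> 0 < v^-1 < 1.
  by move=> v1; rewrite invr_gt0 invf_lt1; lra.
have nat01 (k l : nat) (t : rat) : k%:R = l%:R + t -> 0 < t < 1 -> False.
  move=> kE /andP[t0 t1].
  have : (l < k)%N by rewrite -(ltr_nat rat); lra.
  by rewrite -(ler_nat rat) -natr1; lra.
have one_more (k l : nat) t (ne : t != [::]) (al : all (leq 1) t) :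
    (k%:R : rat) = l%:R + (cf_val t)^-1 -> t = [:: 1%N].
  move=> E; apply/eqP; have [ge1 eq1] := cf_val_ge1 ne al; rewrite -eq1 eq_sym.
  apply: contraT; rewrite neq_lt ltNge ge1 /= => /inv_lt1 lt.
  by case: (nat01 _ _ _ E lt).
elim: a b => // k s IH [//|l t] _ _; rewrite !cf_val_cons.
move=> /= /negb_inj oE als alt.
have [s0|s0] := eqVneq s [::]; have [t0|t0] := eqVneq t [::].
- by rewrite s0 t0 /= invr0 !addr0 => /eqP; rewrite eqr_nat => /eqP ->.
- rewrite {1}s0 /= invr0 addr0 => /(one_more _ _ _ t0 alt) t1.
  by rewrite s0 t1 in oE.
- rewrite {1}t0 /= invr0 addr0 => /esym /(one_more _ _ _ s0 als) s1.
  by rewrite s1 t0 in oE.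
move=> E.
have [s1 es] := cf_val_ge1 s0 als; have [t1 et] := cf_val_ge1 t0 alt.
have is1 : 0 < (cf_val s)^-1 <= 1 by rewrite invr_gt0 invf_le1 ?s1; lra.
have it1 : 0 < (cf_val t)^-1 <= 1 by rewrite invr_gt0 invf_le1 ?t1; lra.
have kl : k = l.
  apply/eqP; rewrite eqn_leq.
  by apply/andP; split; rewrite -ltnS -(ltr_nat rat) -natr1; lra.
rewrite kl in E *; congr (_ :: _).
apply: IH => //.
- by case: (s) als => //= h u /andP[].
- by case: (t) alt => //= h u /andP[].
- by apply: invr_inj; apply: addrI E.
Qed.

(* [even_cf x] is the even-length expansion of [x]; junk when [x <= 0]. *)
Definition even_cf (x : rat) : seq nat := xchoose (even_cf_exists x).

Lemma even_cfP (x : rat) : 0 < x -> is_even_cf x (even_cf x).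
Proof. exact: (implyP (xchooseP (even_cf_exists x))). Qed.

Lemma even_cf_unique (x : rat) (a : seq nat) : is_even_cf x a -> even_cf x = a.
Proof.
move=> Ha; have /and4P[a0 oa ala /eqP va] := Ha.
have x0 : 0 < x.
  rewrite -va; case: a a0 oa ala {Ha va} => // k [//|l s] _ _ al.
  rewrite cf_val_cons ltr_wpDl ?ler0n // invr_gt0.
  exact: lt_le_trans ltr01 (cf_val_ge1 _ al).1.
have /and4P[b0 ob alb /eqP vb] := even_cfP x0.
apply: cf_val_uniq => //; last by rewrite va.
by rewrite (negbTE oa) (negbTE ob).
Qed.

(* Words over {0, 1}: the letter 0 is [false], the letter 1 is [true]. *)
Definition word := seq bool.

(* Alternating blocks starting with the letter [b], the last one shortened by
   one letter. *)
Fixpoint blocks (b : bool) (a : seq nat) : word :=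
  match a with
  | [::] => [::]
  | [:: k] => nseq k.-1 b
  | k :: s => nseq k b ++ blocks (~~ b) s
  end.

Definition W (x : rat) : word := blocks true (even_cf x).

Fixpoint theta (w : word) : word :=
  match w with
  | [::] => [::]
  | c :: v => (if odd (size v) then c else ~~ c) :: theta v
  end.

Definition point := (int * int)%type.
Definition edge := {fset point}.

Definition vec (p : word) : point :=
  ((count_mem false p)%:Z, (count_mem true p)%:Z).

Definition prefixes (w : word) : seq word :=
  [seq take i w | i <- iota 0 (size w).+1].

Definition corners : {fset point} := [fset (0, 0); (1, 0); (0, 1); (1, 1)].

Definition hedge (g : point) : edge := [fset g; g + (1, 0)].
Definition vedge (g : point) : edge := [fset g; g + (0, 1)].

Definition square (g : point) : {fset edge} :=
  [fset hedge g; hedge (g + (0, 1)); vedge g; vedge (g + (1, 0))].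

Definition snake_vertices (w : word) : {fset point} :=
  [fset vec p + c | p in prefixes w, c in corners].

Definition snake_edges (w : word) : {fset edge} :=
  \bigcup_(p <- prefixes w) square (vec p).

Definition perfect_matching (w : word) (M : {fset edge}) : bool :=
  (M `<=` snake_edges w) &&
  all (fun v => #|` [fset e in M | v \in e]| == 1%N) (snake_vertices w).

Definition perfect_matchings (w : word) : {fset {fset edge}} :=
  [fset M in fpowerset (snake_edges w) | perfect_matching w M].

Definition horizontal (e : edge) : bool :=
  [forall u : e, forall v : e, (val u).2 == (val v).2].
Definition vertical (e : edge) : bool :=
  [forall u : e, forall v : e, (val u).1 == (val v).1].

(* In a perfect matching exactly one edge contains (0, 0). *)
Definition first_edge_is (P : pred edge) (M : {fset edge}) : bool :=
  has (fun e : edge => ((0, 0) \in e) && P e) M.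

Definition perp_matching (w : word) (M : {fset edge}) : bool :=
  (~~ odd (size w) && first_edge_is horizontal M)
  || (odd (size w) && first_edge_is vertical M).

Definition snake_word (x : rat) : word := theta (W x).

Definition M_perp (x : rat) : {fset {fset edge}} :=
  [fset M in perfect_matchings (snake_word x) | perp_matching (snake_word x) M].

Definition M_par (x : rat) : {fset {fset edge}} :=
  [fset M in perfect_matchings (snake_word x) | ~~ perp_matching (snake_word x) M].

(* Main.v *)
Require Import Defs.
From mathcomp Require Import all_boot all_order all_algebra.
From mathcomp Require Import finmap.
From mathcomp Require Import zify ring.

Set Implicit Arguments.
Unset Strict Implicit.
Unset Printing Implicit Defensive.

Import Order.TTheory GRing.Theory Num.Theory.
Local Open Scope fset_scope.
Local Open Scope ring_scope.

(* Let c be the first letter of w and G' the snake graph of the remaining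
   letters; the first square of G(w) meets G' in an edge s, opposite to a rung r.
   A matching of G(w) either contains r, and the rest is any matching of G', or it
   contains the two sides joining r to s, and the rest is a matching of G' through s
   with s removed.  The twist theta turns this into: prepending 1 to W sends
   (perp, par) = (p, q) to (p + q, q), prepending 0 sends it to (p, p + q), starting
   from (1, 1).  On p / q these are v |-> 1 + v and 1/v |-> 1 + 1/v, which read off
   the continued fraction block by block, and both preserve coprimality. *)

(** * Exact covers of a vertex set by given edges *)

Lemma in_fset_sep (T : choiceType) (A : {fset T}) (P : pred T) x :
  (x \in [fset y in A | P y]) = (x \in A) && P x.
Proof. by rewrite in_fset /= inE. Qed.

Section Matchings.

Variable K : choiceType.
Implicit Types (V e : {fset K}) (E M : {fset {fset K}}).

(* An edge of [E] may have endpoints outside [V]; those are not constrained. *)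
Definition matchings V E : {fset {fset {fset K}}} :=
  [fset M in fpowerset E | all (fun v => #|` [fset e in M | v \in e]| == 1%N) V].

Definition avoiding E e : {fset {fset K}} := [fset f in E | fdisjoint f e].

Lemma matchingsP V E M :
  reflect (M `<=` E /\ forall v, v \in V ->
             exists2 e, e \in M /\ v \in e & forall f, f \in M -> v \in f -> f = e)
          (M \in matchings V E).
Proof.
rewrite !inE /= fpowersetE.
apply: (iffP andP) => -[ME H]; split=> //.
  move=> v vV; have /cardfs1P[e He] := allP H v vV.
  have : e \in [fset e in M | v \in e] by rewrite He inE.
  rewrite !inE /= => /andP[eM ve]; exists e => // f fM vf.
  have : f \in [fset e in M | v \in e] by rewrite !inE /= fM.
  by rewrite He inE => /eqP.
apply/allP => v /H[e [eM ve] ue]; apply/cardfs1P; exists e; apply/fsetP => f.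
rewrite !inE /=; apply/andP/eqP => [[fM vf]|->] //; exact: ue.
Qed.

(** Erasing [e] is a bijection, inverted by adding [e] back. Nonemptiness of [e] keeps it from being
    disjoint from itself, so [e] never occurs in the smaller matching and adding it is injective. *)
Lemma card_matchings_edge V E e : e \in E -> e `<=` V -> e != fset0 ->
  #|` [fset M in matchings V E | e \in M]| = #|` matchings (V `\` e) (avoiding E e)|.
Proof.
move=> eE eV /fset0Pn[v0 v0e].
have nav M : M `<=` avoiding E e -> forall f, f \in M -> [/\ f \in E & fdisjoint f e].
  by move=> /fsubsetP sub f /sub; rewrite !inE /= => /andP[].
have enav M : M `<=` avoiding E e -> e \notin M.
  move=> sub; apply/negP => /(nav _ sub)[_ /fdisjointP/(_ v0 v0e)].
  by rewrite v0e.
have -> : [fset M in matchings V E | e \in M]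
   = [fset e |` M | M in matchings (V `\` e) (avoiding E e)].
  apply/fsetP => M; apply/idP/imfsetP.
    rewrite in_fset_sep => /andP[/matchingsP[/fsubsetP ME HM] eM].
    exists (M `\ e); last by rewrite fsetD1K.
    apply/matchingsP; split.
      apply/fsubsetP => f; rewrite !inE /= => /andP[fe fM].
      rewrite ME //=; apply/fdisjointP => v vf; apply/negP => ve.
      (* An edge of [M] sharing a vertex [v] with [e] equals [e], by uniqueness of the cover at
         [v]. *)
      have [h _ uh] := HM v (fsubsetP eV v ve).
      by rewrite (uh f) // -(uh e) // eqxx in fe.
    move=> v; rewrite !inE => /andP[ve vV].
    have [h [hM vh] uh] := HM v vV; exists h.
      by split=> //; rewrite !inE hM andbT; apply: contraNneq ve => <-.
    by move=> f; rewrite !inE => /andP[_]; apply: uh.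
  move=> [N /matchingsP[NE HN] ->]; rewrite in_fset_sep fset1U1 andbT.
  apply/matchingsP; split.
    apply/fsubsetP => f; rewrite !inE => /orP[/eqP->//|].
    by move=> /(nav _ NE)[].
  move=> v vV; have [ve|ve] := boolP (v \in e).
    exists e; first by rewrite !inE eqxx.
    move=> f; rewrite !inE => /orP[/eqP//|/(nav _ NE)[_ /fdisjointP d]] vf.
    by have := d v vf; rewrite ve.
  have [|h [hN vh] uh] := HN v; first by rewrite !inE ve.
  exists h; first by rewrite !inE hN orbT.
  move=> f; rewrite !inE => /orP[/eqP->|]; last exact: uh.
  by rewrite (negbTE ve).
apply: card_in_imfset => M N /matchingsP[ME _] /matchingsP[NE _] /= eqMN.
by rewrite -(fsetU1K (enav M ME)) eqMN fsetU1K ?enav.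
Qed.

Lemma avoidingP E e f : reflect (f \in E /\ fdisjoint f e) (f \in avoiding E e).
Proof. by rewrite !inE; apply: andP. Qed.

Lemma matchings_edge (e : {fset K}) : e != fset0 -> matchings e [fset e] = [fset [fset e]].
Proof.
move=> /fset0Pn[v ve]; apply/fsetP => M; rewrite in_fset1; apply/matchingsP/eqP.
  move=> [/fsubsetP ME /(_ v ve)[f [fM _] _]]; apply/fsetP => h; apply/idP/idP => [/ME//|].
  by rewrite inE => /eqP->; have := ME f fM; rewrite inE => /eqP <-.
move=> ->; split=> // u ue; exists e; first by rewrite inE.
by move=> f; rewrite inE => /eqP.
Qed.

(** * Gluing a square to a graph along an edge *)

Section Ladder.

Variables (V : {fset K}) (E : {fset {fset K}}) (a b c d : K).
Hypotheses (neq_ab : a != b) (neq_cd : c != d).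
Hypotheses (aV : a \notin V) (bV : b \notin V) (cV : c \in V) (dV : d \in V).
Hypotheses (EV : forall e, e \in E -> e `<=` V) (cdE : [fset c; d] \in E).

(** The glued square has the rung [[fset a; b]], the sides [[fset a; c]] and [[fset b; d]], and the
    old edge [[fset c; d]] opposite to the rung. *)
Let V2 := a |` (b |` V).
Let E2 := [fset a; b] |` ([fset a; c] |` ([fset b; d] |` E)).

Let inE2 f : (f \in E2) = [|| f == [fset a; b], f == [fset a; c], f == [fset b; d] | f \in E].
Proof. by rewrite !inE. Qed.

Let fset2_n0 (x y : K) : [fset x; y] != fset0.
Proof. by apply/fset0Pn; exists x; rewrite !inE eqxx. Qed.

Let neqV x y : x \notin V -> y \in V -> x != y.
Proof. by move=> xV yV; apply: contraNneq xV => ->. Qed.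

Let disjE e x y : e \in E -> x \notin V -> fdisjoint e [fset x; y] = (y \notin e).
Proof.
move=> /EV eV xV; apply/fdisjointP/idP => [H|ye u ue].
  by apply/negP => /H; rewrite !inE eqxx orbT.
rewrite !inE negb_or; apply/andP; split.
  by rewrite eq_sym; apply: neqV => //; apply: (fsubsetP eV).
by apply: contraNneq ye => <-.
Qed.

Let disj2 (x y z t : K) : fdisjoint [fset x; y] [fset z; t] =
  [&& x != z, x != t, y != z & y != t].
Proof.
by rewrite fdisjointUX !fdisjoint1X !inE !negb_or -!andbA.
Qed.

(** Both sides meet the rung, while no edge of [E] does, as [a] and [b] lie outside [V]. So choosing
    the rung leaves exactly [V] and [E]. *)
Lemma card_matchings_ladder_rung :
  #|` [fset M in matchings V2 E2 | [fset a; b] \in M]| = #|` matchings V E|.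
Proof.
rewrite card_matchings_edge //; first 1 last.
- by rewrite !inE eqxx.
- by apply/fsubsetP => x; rewrite !inE => /orP[]/eqP->; rewrite eqxx ?orbT.
congr (#|` matchings _ _|).
  apply/fsetP => x; rewrite !inE negb_or.
  have [->|] := eqVneq x a; first by rewrite (negbTE aV).
  have [->|] := eqVneq x b; first by rewrite (negbTE bV).
  by [].
apply/fsetP => f; apply/avoidingP/idP => [[]|fE].
  rewrite inE2 => /or4P[/eqP->|/eqP->|/eqP->|//]; rewrite disj2 eqxx ?andbF //.
split; first by rewrite inE2 fE !orbT.
by rewrite disjE //; apply: contraNN bV => bf; apply: fsubsetP (EV fE) _ bf.
Qed.

(* Taking the edge [a c] leaves [b d] as the only way to cover [b]. *)
Lemma card_matchings_ladder_side :
  #|` [fset M in matchings V2 E2 | [fset a; c] \in M]|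
  = #|` [fset M in matchings V E | [fset c; d] \in M]|.
Proof.
have ac := neqV aV cV; have ad := neqV aV dV.
have bc := neqV bV cV; have bd := neqV bV dV.
rewrite card_matchings_edge //; first 1 last.
- by rewrite !inE eqxx orbT.
- by apply/fsubsetP => x; rewrite !inE => /orP[]/eqP->; rewrite ?eqxx ?cV ?orbT.
rewrite [RHS]card_matchings_edge //; first 1 last.
- by apply/fsubsetP => x; rewrite !inE => /orP[]/eqP->.
set V1 := _ `\` _; set E1 := avoiding _ _.
have bdE1 : [fset b; d] \in E1.
  apply/avoidingP; split; first by rewrite !inE eqxx !orbT.
  by rewrite disj2 (eq_sym b) neq_ab bc (eq_sym d) ad (eq_sym d) neq_cd.
have bV1 : b \in V1 by rewrite !inE eqxx orbT andbT negb_or (eq_sym b) neq_ab bc.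
(* Seeing the whole set as its part through the forced edge lets [card_matchings_edge] apply a
   second time. *)
have -> : matchings V1 E1 = [fset M in matchings V1 E1 | [fset b; d] \in M].
  apply/fsetP => M; rewrite in_fset_sep.
  apply/idP/andP => [MV|[]//]; split=> //.
  have [/fsubsetP ME /(_ b bV1)[e [eM be] _]] := matchingsP _ _ _ MV.
  have /avoidingP[] := ME e eM.
  rewrite inE2 => /or4P[/eqP eE|/eqP eE|/eqP <-//|/EV /fsubsetP/(_ b be)].
  - by rewrite eE disj2 eqxx.
  - by rewrite eE disj2 eqxx.
  - by rewrite (negbTE bV).
rewrite card_matchings_edge //; last first.
  apply/fsubsetP => x; rewrite !inE => /orP[]/eqP->; rewrite ?eqxx ?dV ?orbT ?andbT negb_or.
    by rewrite eq_sym neq_ab.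
  by rewrite !(eq_sym d) ad.
(* Removing both sides takes away the same vertices of [V], and the same edges of [E], as removing
   [[fset c; d]]. *)
congr (#|` matchings _ _|).
  apply/fsetP => x; rewrite !inE !negb_or.
  have [->|] := eqVneq x a; first by rewrite (negbTE aV) !andbF.
  have [->|] := eqVneq x b; first by rewrite (negbTE bV) !andbF.
  by rewrite /= andbA [(x != d) && _]andbC.
apply/fsetP => f; apply/avoidingP/avoidingP => [[/avoidingP[]]|[fE]].
  rewrite inE2 => /or4P[/eqP->|/eqP->|/eqP->|fE]; rewrite ?disj2 ?eqxx ?andbF //.
  rewrite (disjE _ fE aV) (disjE _ fE bV) => cf df; split=> //.
  apply/fdisjointP => x xf; rewrite !inE negb_or.
  by apply/andP; split; [apply: contraNneq cf | apply: contraNneq df] => <-.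
move=> /fdisjointP H; split; last first.
  by rewrite disjE //; apply/negP => /H; rewrite in_fset2 eqxx orbT.
apply/avoidingP; split; first by rewrite inE2 fE !orbT.
by rewrite disjE //; apply/negP => /H; rewrite !inE eqxx.
Qed.

End Ladder.

End Matchings.

(** * Snake graphs built letter by letter from a base point *)

Definition unit_step (c : bool) : point := if c then (0, 1) else (1, 0).

(** One family for [hedge] and [vedge], indexed by a letter, so that both directions are treated at
    once. *)
Definition segment (c : bool) (g : point) : edge := [fset g; g + unit_step c].

Definition square_vertices (g : point) : {fset point} :=
  [fset g; g + (1, 0); g + (0, 1); g + (1, 1)].

(** The moving corner [g] makes the graph left after dropping the first letter a strip again, as the
    induction requires. *)
Fixpoint strip_vertices (g : point) (w : word) : {fset point} :=
  if w is c :: v then square_vertices g `|` strip_vertices (g + unit_step c) v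
  else square_vertices g.

Fixpoint strip_edges (g : point) (w : word) : {fset edge} :=
  if w is c :: v then square g `|` strip_edges (g + unit_step c) v
  else square g.

Definition strip_matchings g w := matchings (strip_vertices g w) (strip_edges g w).

Lemma segment_neq0 c g : segment c g != fset0.
Proof. by apply/fset0Pn; exists g; rewrite !inE eqxx. Qed.

Lemma far_corner c (g : point) : g + unit_step c + unit_step (~~ c) = g + (1, 1).
Proof. by case: c g => -[x y]; congr (_, _) => /=; lia. Qed.

(** Puts the square into ladder form for a step [c]: [g] and [g + unit_step (~~ c)] span the rung,
    and the last segment is the edge shared with the next square. *)
Lemma square_verticesE c g : square_vertices g =
  g |` (g + unit_step (~~ c) |` segment (~~ c) (g + unit_step c)).
Proof.
rewrite /segment far_corner; apply/fsetP => v; rewrite !inE.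
by case: c; rewrite /unit_step /= -!orbA; do !bool_congr; rewrite orbCA.
Qed.

Lemma squareE c g : square g =
  [fset g; g + unit_step (~~ c)]
  |` ([fset g; g + unit_step c]
  |` ([fset g + unit_step (~~ c); g + unit_step c + unit_step (~~ c)]
  |` [fset segment (~~ c) (g + unit_step c)])).
Proof.
apply/fsetP => e; rewrite far_corner !inE /hedge /vedge /segment.
have E1 : g + (0, 1) + (1, 0) = g + (1, 1) by exact: (far_corner true).
have E2 : g + (1, 0) + (0, 1) = g + (1, 1) by exact: (far_corner false).
case: c; rewrite /unit_step /= E1 E2;
by do 4 case: (e == _).
Qed.

Lemma square_vertices_sub g w : square_vertices g `<=` strip_vertices g w.
Proof. by case: w => //= c v; apply: fsubsetUl. Qed.

Lemma square_sub g w : square g `<=` strip_edges g w.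
Proof. by case: w => //= c v; apply: fsubsetUl. Qed.

Lemma segment_sub c g : segment c g `<=` square_vertices g.
Proof.
rewrite (square_verticesE c); apply/fsubsetP => v.
by rewrite !inE => /orP[]->; rewrite ?orbT.
Qed.

Lemma segment_square c g : segment c g \in square g.
Proof. by rewrite (squareE c) !inE /segment eqxx orbT. Qed.

Lemma strip_edges_sub g w e : e \in strip_edges g w -> e `<=` strip_vertices g w.
Proof.
have sq h : e \in square h -> e `<=` square_vertices h.
  rewrite (squareE true) (square_verticesE true) /segment => He.
  apply/fsubsetP => v; move: He; rewrite !inE.
  by case/or4P => /eqP->; rewrite !inE => /orP[]->; rewrite ?orbT.
elim: w g => [g|c w IH g] /=; first exact: sq.
rewrite inE => /orP[/sq|/IH] H; apply: fsubset_trans H _.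
  exact: fsubsetUl.
exact: fsubsetUr.
Qed.

Lemma strip_vertices_ge g w v : v \in strip_vertices g w ->
  (g.1 <= v.1) && (g.2 <= v.2).
Proof.
have sq h : v \in square_vertices h -> (h.1 <= v.1) && (h.2 <= v.2).
  by case: h => x y; rewrite !inE -!orbA => /or4P[]/eqP->; apply/andP; split=> /=; lia.
elim: w g => [g|c w IH g] /=; first exact: sq.
rewrite inE => /orP[/sq//|/IH]; case: c g => -[x y]; case: v {IH sq} => z t /=; lia.
Qed.

Lemma strip_vertices_cons g c w : strip_vertices g (c :: w) =
  g |` (g + unit_step (~~ c) |` strip_vertices (g + unit_step c) w).
Proof.
rewrite /= (square_verticesE c) -2!fsetUA; do 2 congr (_ `|` _); apply/fsetUidPr.
exact: fsubset_trans (segment_sub _ _) (square_vertices_sub _ _).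
Qed.

Lemma strip_edges_cons g c w : strip_edges g (c :: w) =
  [fset g; g + unit_step (~~ c)]
  |` ([fset g; g + unit_step c]
  |` ([fset g + unit_step (~~ c); g + unit_step c + unit_step (~~ c)]
  |` strip_edges (g + unit_step c) w)).
Proof.
rewrite /= (squareE c) -3!fsetUA; do 3 congr (_ `|` _); apply/fsetUidPr.
rewrite fsub1set; exact: (fsubsetP (square_sub _ _)) (segment_square _ _).
Qed.

Lemma add_unit_step_neq (g : point) c : g != g + unit_step c.
Proof. by case: c g => -[x y]; rewrite /eq_op /= ; lia. Qed.

(** The step raises the coordinate in direction [c], which never drops afterwards, while both ends
    of the rung keep its old value. *)
Lemma notin_strip_step g c w :
  (g \notin strip_vertices (g + unit_step c) w) &&
  (g + unit_step (~~ c) \notin strip_vertices (g + unit_step c) w).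
Proof.
by apply/andP; split; apply/negP => /strip_vertices_ge;
  case: c g => -[x y] /=; lia.
Qed.

(** * Recursion for the matchings through a given corner edge *)

Definition num_matchings c g w :=
  #|` [fset M in strip_matchings g w | segment c g \in M]|.

Lemma edges_at_corner g w e : e \in strip_edges g w -> g \in e ->
  exists c, e = segment c g.
Proof.
(* A single square lies in the strip of [[:: true]], so the word may be taken nonempty and the
   ladder form used. *)
wlog [c [v ->]] : w / exists c v, w = c :: v.
  case: w => [|c v] H; last by apply: H; exists c, v.
  by move=> eE; apply: (H [:: true]); [exists true, [::] | rewrite /= inE eE].
rewrite strip_edges_cons => He ge; have /andP[gV _] := notin_strip_step g c v.
move: He; rewrite !in_fset1U => /or4P[/eqP->|/eqP->|/eqP eE|].
- by exists (~~ c).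
- by exists c.
- move: ge; rewrite eE far_corner !inE (negbTE (add_unit_step_neq _ _)) /=.
  by case: (g) => x y; rewrite /eq_op /=; lia.
- by move=> /strip_edges_sub /fsubsetP /(_ g ge); rewrite (negbTE gV).
Qed.

Lemma segment_inj g : injective (segment^~ g).
Proof.
have H : segment true g <> segment false g.
  move/fsetP => /(_ (g + (0, 1))); rewrite !inE eqxx orbT.
  by case: (g) => x y; rewrite /eq_op /=; lia.
by case=> -[] // E; case: H.
Qed.

(** The corner edge transverse to the step is the rung. *)
Lemma num_matchings_cons_rung c g w :
  num_matchings (~~ c) g (c :: w) = #|` strip_matchings (g + unit_step c) w|.
Proof.
have /andP[gV hV] := notin_strip_step g c w.
rewrite /num_matchings /strip_matchings strip_vertices_cons strip_edges_cons.
by apply: card_matchings_ladder_rung => //; exact: strip_edges_sub.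
Qed.

(** The corner edge along the step is a side, and the shared edge is the transverse corner edge of
    the next square. *)
Lemma num_matchings_cons_side c g w :
  num_matchings c g (c :: w) = num_matchings (~~ c) (g + unit_step c) w.
Proof.
have /andP[gV hV] := notin_strip_step g c w.
have sV v : v \in segment (~~ c) (g + unit_step c) ->
    v \in strip_vertices (g + unit_step c) w.
  by apply: fsubsetP; apply: fsubset_trans (segment_sub _ _) (square_vertices_sub _ _).
rewrite /num_matchings /strip_matchings strip_vertices_cons strip_edges_cons.
apply: card_matchings_ladder_side => //.
- exact: add_unit_step_neq.
- exact: add_unit_step_neq.
- by apply: sV; rewrite !inE eqxx.
- by apply: sV; rewrite !inE eqxx orbT.
- exact: strip_edges_sub.
- exact: (fsubsetP (square_sub _ _)) (segment_square _ _).
Qed.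

(** A single square is a ladder over just one edge, which has a unique matching. *)
Lemma num_matchings_nil c g : num_matchings c g [::] = 1%N.
Proof.
have nV v : v \in segment (~~ c) (g + unit_step c) ->
    v \in strip_vertices (g + unit_step c) [::].
  by apply: fsubsetP; apply: segment_sub.
have /andP[gV hV] := notin_strip_step g c [::].
rewrite /num_matchings /strip_matchings /= (square_verticesE c) (squareE c).
rewrite card_matchings_ladder_side; first 1 last.
- exact: add_unit_step_neq.
- exact: add_unit_step_neq.
- by apply: contraNN gV => /nV.
- by apply: contraNN hV => /nV.
- by rewrite !inE eqxx.
- by rewrite !inE eqxx orbT.
- by move=> e; rewrite in_fset1 => /eqP->.
- by rewrite in_fset1.
rewrite matchings_edge ?segment_neq0 //; apply/eqP/cardfs1P.
exists [fset segment (~~ c) (g + unit_step c)].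
apply/fsetP => M; rewrite in_fset_sep in_fset1.
by case: eqVneq => //= ->; rewrite in_fset1 eqxx.
Qed.

(** The corner [g] is covered exactly once, and only its two segments can cover it. *)
Lemma strip_matching_segment g w M c : M \in strip_matchings g w ->
  (segment (~~ c) g \in M) = (segment c g \notin M).
Proof.
move=> /matchingsP[/fsubsetP ME HM].
have [|e [eM ge] ue] := HM g.
  by apply: (fsubsetP (square_vertices_sub _ _)); rewrite !inE eqxx.
have gs b : g \in segment b g by rewrite !inE eqxx.
have [b eE] := edges_at_corner (ME e eM) ge; rewrite {}eE in eM ue.
have H d : (segment d g \in M) = (d == b).
  by apply/idP/eqP => [dM|->//]; apply: segment_inj (ue _ dM (gs d)).
by rewrite !H; case: (c) (b) => -[].
Qed.

Lemma card_strip_matchings c g w :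
  #|` strip_matchings g w| = (num_matchings c g w + num_matchings (~~ c) g w)%N.
Proof.
rewrite /num_matchings -cardfsUI [X in (_ + #|` X|)%N](_ : _ = fset0).
  rewrite cardfs0 addn0; congr #|` _|; apply/fsetP => M.
  rewrite in_fsetU !(in_fset_sep (strip_matchings g w)) -andb_orr.
  case: (boolP (M \in _)) => //= MS.
  by rewrite (strip_matching_segment c MS) orbN.
apply/fsetP => M; rewrite in_fsetI !(in_fset_sep (strip_matchings g w)) in_fset0.
case: (boolP (M \in _)) => //= MS.
by rewrite (strip_matching_segment c MS) andbN.
Qed.

(** * Strips from the origin are the snake graphs *)

Lemma prefixes_cons c w : prefixes (c :: w) = [::] :: map (cons c) (prefixes w).
Proof.
rewrite {1}/prefixes -[iota 0 _]/(0%N :: iota (1 + 0) (size w).+1) iotaDl /=.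
by rewrite -!map_comp.
Qed.

Lemma vec_cons c p : vec (c :: p) = unit_step c + vec p.
Proof. by rewrite /vec; case: c; congr (_, _) => /=; lia. Qed.

Lemma addr_vec0 g : g + vec [::] = g.
Proof. exact: addr0. Qed.

Lemma mem_strip_vertices g w v : (v \in strip_vertices g w) =
  has (fun p => v \in square_vertices (g + vec p)) (prefixes w).
Proof.
elim: w g => [|c w IH] g; first by rewrite /= addr_vec0 orbF.
rewrite prefixes_cons [RHS]/= addr_vec0 has_map in_fsetU IH; congr (_ || _).
by apply: eq_has => p /=; rewrite vec_cons addrA.
Qed.

Lemma mem_strip_edges g w e : (e \in strip_edges g w) =
  has (fun p => e \in square (g + vec p)) (prefixes w).
Proof.
elim: w g => [|c w IH] g; first by rewrite /= addr_vec0 orbF.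
rewrite prefixes_cons [RHS]/= addr_vec0 has_map in_fsetU IH; congr (_ || _).
by apply: eq_has => p /=; rewrite vec_cons addrA.
Qed.

Lemma mem_square_vertices g v :
  reflect (exists2 k, k \in corners & v = g + k) (v \in square_vertices g).
Proof.
rewrite !inE -!orbA; apply: (iffP or4P).
  case=> /eqP->; [exists 0 | exists (1, 0) | exists (0, 1) | exists (1, 1)];
    by rewrite ?addr0 // !inE.
case=> k; rewrite !inE -!orbA => /or4P[]/eqP-> ->; rewrite ?addr0 ?eqxx;
  by [constructor 1 | constructor 2 | constructor 3 | constructor 4].
Qed.

Lemma snake_verticesE w : snake_vertices w = strip_vertices 0 w.
Proof.
apply/fsetP => v; rewrite mem_strip_vertices; apply/imfset2P/hasP.
  move=> [p pw [k kC ->]]; exists p => //; apply/mem_square_vertices.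
  by exists k; rewrite // add0r.
move=> [p pw /mem_square_vertices[k kC ->]]; exists p => //.
by exists k; rewrite // add0r.
Qed.

Lemma snake_edgesE w : snake_edges w = strip_edges 0 w.
Proof.
apply/fsetP => e; rewrite mem_strip_edges; apply/bigfcupP/hasP.
  by move=> [p /andP[pw _] ep]; exists p; rewrite ?add0r.
by move=> [p pw]; rewrite add0r => ep; exists p; rewrite ?pw.
Qed.

Lemma perfect_matchingsE w : perfect_matchings w = strip_matchings 0 w.
Proof.
apply/fsetP => M; rewrite /perfect_matchings /strip_matchings /matchings.
rewrite !(in_fset_sep (fpowerset _)) fpowersetE /perfect_matching.
by rewrite snake_verticesE snake_edgesE !fpowersetE andbA andbb.
Qed.

(** * Perp- and par-matchings through the direction of the first edge *)

Definition oriented (c : bool) : edge -> bool := if c then vertical else horizontal.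

Lemma oriented_segment b c g : oriented b (segment c g) = (b == c).
Proof.
have g0 : g \in segment c g by rewrite !inE eqxx.
have g1 : g + unit_step c \in segment c g by rewrite !inE eqxx orbT.
have mem (u : segment c g) : val u = g \/ val u = g + unit_step c.
  by have := valP u; rewrite !inE => /orP[]/eqP; [left | right].
rewrite /oriented; case: b; apply/forallP/eqP => [/(_ [` g0])/forallP/(_ [` g1])|cE u].
- by move=> /= {g0 g1 mem}; case: c g => -[x y] //= /eqP; lia.
- apply/forallP => v; case: (mem u) => ->; case: (mem v) => ->; rewrite -?cE;
  by case: (g) => x y /=; apply/eqP; lia.
- by move=> /= {g0 g1 mem}; case: c g => -[x y] //= /eqP; lia.
- apply/forallP => v; case: (mem u) => ->; case: (mem v) => ->; rewrite -?cE;
  by case: (g) => x y /=; apply/eqP; lia.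
Qed.

Lemma first_edge_isE w M c : M \in strip_matchings 0 w ->
  first_edge_is (oriented c) M = (segment c 0 \in M).
Proof.
move=> /matchingsP[/fsubsetP ME HM]; apply/hasP/idP => [[e eM /andP[e0]]|cM].
  have [b eE] := edges_at_corner (ME e eM) e0.
  by rewrite eE oriented_segment in eM * => /eqP->.
by exists (segment c 0); rewrite // oriented_segment eqxx !inE eqxx.
Qed.

(** With [true] standing for vertical, the parity rule says that the direction of the first edge is
    the parity of the word length. *)
Lemma perp_matchingE w M : M \in strip_matchings 0 w ->
  perp_matching w M = (segment (odd (size w)) 0 \in M).
Proof.
move=> MS; rewrite -(first_edge_isE _ MS) /perp_matching.
by case: odd; rewrite ?orbF.
Qed.

Lemma card_M_perp x : #|` M_perp x| =
  num_matchings (odd (size (snake_word x))) 0 (snake_word x).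
Proof.
rewrite /M_perp perfect_matchingsE; congr #|` _|; apply/fsetP => M.
rewrite !(in_fset_sep (strip_matchings 0 _)).
by case: (boolP (M \in _)) => //= /perp_matchingE ->.
Qed.

Lemma card_M_par x : #|` M_par x| =
  num_matchings (~~ odd (size (snake_word x))) 0 (snake_word x).
Proof.
rewrite /M_par perfect_matchingsE; congr #|` _|; apply/fsetP => M.
rewrite !(in_fset_sep (strip_matchings 0 _)); case: (boolP (M \in _)) => //= MS.
by rewrite (perp_matchingE MS) (strip_matching_segment _ MS).
Qed.

(** * The pair of counts and the continued fraction *)

(* [(p, q)] will be the numbers of perp- and par-matchings. *)
Fixpoint ratio (u : word) : nat * nat :=
  if u is c :: v then
    let: (p, q) := ratio v in if c then ((p + q)%N, q) else (p, (p + q)%N)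
  else (1%N, 1%N).

Lemma size_theta u : size (theta u) = size u.
Proof. by elim: u => //= c v ->. Qed.

(** Let [o] be the parity of the length of [u]. Under [theta] the new first step has direction [o]
    for the letter 1 and [~~ o] for 0. The perp edge of the longer word has direction [~~ o], so it
    is the rung exactly for the letter 1. Along a side the direction flips together with the parity,
    so perp continues as perp and par as par. *)
Lemma num_matchings_theta g u :
  (num_matchings (odd (size u)) g (theta u),
   num_matchings (~~ odd (size u)) g (theta u)) = ratio u.
Proof.
elim: u g => [|c u IH] g; first by rewrite /= !num_matchings_nil.
rewrite [LHS]/= [RHS]/= negbK; set o := odd (size u).
set d := if o then c else ~~ c; have := IH (g + unit_step d).
have := num_matchings_cons_rung d g (theta u).
have := num_matchings_cons_side d g (theta u).
rewrite (card_strip_matchings o) -/o => + + <-.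
by rewrite /d; case: (o) (c) => -[] /= -> ->; rewrite // addnC.
Qed.

Lemma ratio_gt0 u : (0 < (ratio u).1)%N && (0 < (ratio u).2)%N.
Proof.
by elim: u => //= c v; case: (ratio v) => p q /= /andP[p0 q0]; case: c => /=; lia.
Qed.

Lemma coprime_ratio u : coprime (ratio u).1 (ratio u).2.
Proof.
elim: u => //= c v; case: (ratio v) => p q /= pq; case: c => /=.
  by rewrite /coprime gcdnC gcdnDr gcdnC.
by rewrite /coprime gcdnDl.
Qed.

Definition ratio_val u : rat := (ratio u).1%:R / (ratio u).2%:R.

Lemma ratio_val_true u : ratio_val (true :: u) = 1 + ratio_val u.
Proof.
rewrite /ratio_val /=; have := ratio_gt0 u; case: (ratio u) => p q /= /andP[p0 q0].
by rewrite natrD; field; rewrite pnatr_eq0; lia.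
Qed.

Lemma ratio_val_false u : (ratio_val (false :: u))^-1 = 1 + (ratio_val u)^-1.
Proof.
rewrite /ratio_val /=; have := ratio_gt0 u; case: (ratio u) => p q /= /andP[p0 q0].
by rewrite !invf_div natrD; field; rewrite pnatr_eq0; lia.
Qed.

Lemma ratio_val_nseq_true k u : ratio_val (nseq k true ++ u) = k%:R + ratio_val u.
Proof.
elim: k => [|k IH]; first by rewrite add0r.
by rewrite /= ratio_val_true IH addrA nat1r.
Qed.

Lemma ratio_val_nseq_false k u :
  (ratio_val (nseq k false ++ u))^-1 = k%:R + (ratio_val u)^-1.
Proof.
elim: k => [|k IH]; first by rewrite add0r.
by rewrite /= ratio_val_false IH addrA nat1r.
Qed.

(** The parity condition makes the last block one of 0s. Blocks of 1s add to the value and blocks of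
    0s to its inverse, so each change of letter is one inversion in the continued fraction. *)
Lemma ratio_val_blocks b a : a != [::] -> odd (size a) = ~~ b ->
  all (leq 1) (if b then behead a else a) ->
  ratio_val (blocks b a) = if b then cf_val a else (cf_val a)^-1.
Proof.
elim: a b => // k [|l s] IH b _ ob.
  case: b ob => // _ /andP[k0 _]; apply: invr_inj; rewrite invrK.
  rewrite [blocks _ _]/= -[nseq _ _]cats0 ratio_val_nseq_false.
  (* The empty word has value 1, which makes up for the letter missing from the last block: (k - 1)
     + 1 = k. *)
  by rewrite /ratio_val /= divr1 invr1 natr1 prednK.
rewrite cf_val_cons => Ha; have IH' := IH (~~ b) isT.
have -> : blocks b [:: k, l & s] = nseq k b ++ blocks (~~ b) (l :: s) by [].
have {IH IH'} E : ratio_val (blocks (~~ b) (l :: s))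
    = if ~~ b then cf_val (l :: s) else (cf_val (l :: s))^-1.
  apply: IH'; first by rewrite -ob /= negbK.
  by case: b Ha {ob} => //= /andP[] // _ /andP[].
case: b {Ha ob} E => /= E; first by rewrite ratio_val_nseq_true E.
by apply: invr_inj; rewrite invrK ratio_val_nseq_false E.
Qed.

Theorem theorem7p10 (x : rat) (hx : 0 < x) :
  x = #|` M_perp x|%:R / #|` M_par x|%:R
  /\ coprime #|` M_perp x| #|` M_par x|.
Proof.
rewrite card_M_perp card_M_par /snake_word size_theta.
have [-> ->] : num_matchings (odd (size (W x))) 0 (theta (W x)) = (ratio (W x)).1
  /\ num_matchings (~~ odd (size (W x))) 0 (theta (W x)) = (ratio (W x)).2.
  by rewrite -(num_matchings_theta 0).
split; last exact: coprime_ratio.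
have /and4P[a0 oa ala /eqP va] := even_cfP hx.
by rewrite -[LHS]va -[RHS]/(ratio_val _) ratio_val_blocks // (negbTE oa).
Qed.
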